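(* Let $n\ge 2$. There exists a weakly circle-preserving map $T:\mathbb{S}^2\to\mathbb{S}^n$ such that its range $T(\mathbb{S}^2)$ consists of exactly $4$ points that do not all lie on a circle.
   Context: $\mathbb{S}^n$ is the unit sphere in $\mathbb{R}^{n+1}$. A circle in $\mathbb{S}^n$ is the intersection of $\mathbb{S}^n$ with a $2$-dimensional affine plane in $\mathbb{R}^{n+1}$, provided the intersection contains more than one point. A function $T:\mathbb{S}^2\to\mathbb{S}^n$ (with $n\ge 2$) is weakly circle-preserving if for every circle $C\subset\mathbb{S}^2$ the image $T(C)$ is contained in some circle $C'\subset\mathbb{S}^n$; no injectivity, continuity or measurability is assumed. *)

(* Defs.v *)
From HB Require Import structures.
From mathcomp Require Import all_boot all_order all_algebra.
From mathcomp Require Import all_classical all_reals.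
Set Implicit Arguments.
Unset Strict Implicit.
Unset Printing Implicit Defensive.
Import Order.TTheory GRing.Theory Num.Theory.
Local Open Scope classical_set_scope.
Local Open Scope ring_scope.

(* The norm is spelled out because the norm MathComp-Analysis puts on row
   vectors is the sup norm. *)
Definition sphere (R : realType) (n : nat) : Type :=
  {x : 'rV[R]_n.+1 | \sum_(i < n.+1) x 0 i ^+ 2 == 1}.

Definition affine_plane (R : realType) (m : nat) (P : set 'rV[R]_m) : Prop :=
  exists (p : 'rV[R]_m) (V : {vspace 'rV[R]_m}),
    \dim V = 2%N /\ P = [set x | x - p \in V].

Definition is_circle (R : realType) (n : nat) (C : set (sphere R n)) : Prop :=
  (exists P : set 'rV[R]_n.+1,
     affine_plane P /\ C = [set x : sphere R n | P (val x)]) /\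
  (exists x y : sphere R n, [/\ C x, C y & x <> y]).

Definition weakly_circle_preserving (R : realType) (n : nat)
    (T : sphere R 2 -> sphere R n) : Prop :=
  forall C : set (sphere R 2), is_circle C ->
    exists C' : set (sphere R n), is_circle C' /\ T @` C `<=` C'.

(* Main.v *)
Require Import Defs.
From HB Require Import structures.
From mathcomp Require Import all_boot all_order all_algebra.
From mathcomp Require Import all_classical all_reals.
Set Implicit Arguments.
Unset Strict Implicit.
Unset Printing Implicit Defensive.
Import Order.TTheory GRing.Theory Num.Theory.
Local Open Scope classical_set_scope.
Local Open Scope ring_scope.

(** Two circles of S^2 meet in at most two points.  Fix one great circle, the
    equator, colour it with three colours and give everything off it a fourth
    colour.  Every circle then misses a colour: the equator misses the fourth
    one, and any other circle meets the equator in at most two points.  Sending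
    the four colours to four non-concyclic points of S^n gives T: a circle is
    sent to at most three points, and three points of a sphere, not all equal,
    lie on a circle.

    The equator is coloured so that this becomes linear algebra valid in every
    dimension: the colour of a vector is read off its last nonzero coordinate
    among the first three, x_0, x_1, x_2, and off the sign of x_0 when x_1 and
    x_2 vanish; in S^2 the equator is x_2 = 0, and its points (1, 0, 0) and
    (-1, 0, 0) have each a colour of their own.  Four points with all four
    colours have difference vectors in echelon form, hence are not coplanar
    ([affine_plane_misses_color]).  Applied in dimension 2 this shows that T
    preserves circles; applied in dimension n, where the image of colour k is
    itself chosen with colour k ([color_point]), it shows that the range of T
    lies on no circle. *)

Lemma exists_superspace_dim (K : fieldType) (vT : vectType K) (U : {vspace vT})
    (d : nat) : (\dim U <= d <= \dim {:vT})%N ->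
  exists W : {vspace vT}, (U <= W)%VS /\ \dim W = d.
Proof.
case/andP=> leUd led.
pose X := take (d - \dim U) (vbasis U^C).
have szX : size X = (d - \dim U)%N.
  rewrite size_takel // size_tuple.
  by rewrite dimv_compl leq_sub2r.
have freeX : free X.
  have := basis_free (vbasisP U^C).
  by rewrite -{1}(cat_take_drop (d - \dim U) (vbasis U^C)) => /catl_free.
have XU : (<<X>> <= U^C)%VS.
  by apply/span_subvP => x /mem_take; exact: vbasis_mem.
exists (U + <<X>>)%VS; split; first exact: addvSl.
rewrite dimv_disjoint_sum; last first.
  by apply/eqP; rewrite -subv0 -(capv_compl U) capvS.
by move: freeX; rewrite /free szX => /eqP ->; rewrite subnKC.
Qed.

(** The points span an affine space of dimension at most 2, which fits into a
    plane since the ambient space has dimension at least 2. *)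
Lemma exists_circle3 (R : realType) (n : nat) (x y z : sphere R n) :
  (1 <= n)%N -> x <> y ->
  exists C : set (sphere R n), [/\ is_circle C, C x, C y & C z].
Proof.
move=> n1 neq_xy.
pose X := [:: val y - val x; val z - val x].
have [|V [XV dimV]] := @exists_superspace_dim _ _ <<X>>%VS 2.
  rewrite dimvf /dim /= mul1n ltnS n1 andbT.
  exact: (leq_trans (dim_span X)).
have memV u : u \in X -> u \in V by move=> uX; rewrite (subvP XV) // memv_span.
pose C := [set u : sphere R n | val u - val x \in V].
have Cx : C x by rewrite /C /= subrr mem0v.
have Cy : C y by apply: memV; rewrite mem_head.
have Cz : C z by apply: memV; rewrite !inE eqxx orbT.
exists C; split => //; split; last by exists x, y.
by exists [set u | u - val x \in V]; split=> //; exists (val x), V.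
Qed.

Lemma echelon3_dim (K : fieldType) (m : nat) (V : {vspace 'rV[K]_m})
    (u v w : 'rV[K]_m) (i j k : 'I_m) :
    u \in V -> v \in V -> w \in V ->
    u 0 i != 0 -> u 0 j = 0 -> u 0 k = 0 -> v 0 j != 0 -> v 0 k = 0 ->
    w 0 k != 0 ->
  (3 <= \dim V)%N.
Proof.
move=> uV vV wV ui uj uk vj vk wk.
have freeX : free [:: w; v; u].
  rewrite !free_cons span_cons span_seq1 nil_free andbT.
  apply/and3P; split.
  - apply: contra wk => /memv_addP[_ /vlineP[a ->]] [_ /vlineP[b ->] ->].
    by rewrite !mxE uk vk !mulr0 addr0.
  - by apply: contra vj => /vlineP[a ->]; rewrite mxE uj mulr0.
  - by rewrite span_nil memv0; apply: contra ui => /eqP ->; rewrite mxE.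
rewrite -(eqP freeX : \dim _ = 3%N); apply: dimvS; apply/span_subvP => x.
by rewrite !inE => /or3P[] /eqP ->.
Qed.

Definition color (R : realType) (n : nat) (x : 'rV[R]_n.+1) : nat :=
  if x 0 (inord 2) != 0 then 3%N else
  if x 0 (inord 1) != 0 then 2%N else nat_of_bool (0 < x 0 (inord 0)).

Lemma ltn_color (R : realType) (n : nat) (x : 'rV[R]_n.+1) : (color x < 4)%N.
Proof. by rewrite /color; do 2!case: ifP => // _; case: (0 < _). Qed.

Lemma color_coord (R : realType) (n : nat) (x : 'rV[R]_n.+1) :
  match color x with
  | 0 => [/\ x 0 (inord 0) <= 0, x 0 (inord 1) = 0 & x 0 (inord 2) = 0]
  | 1 => [/\ 0 < x 0 (inord 0), x 0 (inord 1) = 0 & x 0 (inord 2) = 0]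
  | 2 => x 0 (inord 1) != 0 /\ x 0 (inord 2) = 0
  | _ => x 0 (inord 2) != 0
  end.
Proof.
rewrite /color; case: (eqVneq (x 0 (inord 2)) 0) => //= x2.
by case: (eqVneq (x 0 (inord 1)) 0) => //= x1; case: ltP.
Qed.

(** Subtract a point of colour 0 from points of colours 1, 2 and 3: the
    differences are in echelon form, so their direction space is too large. *)
Lemma affine_plane_misses_color (R : realType) (n : nat) (P : set 'rV[R]_n.+1) :
  affine_plane P -> exists2 k, (k < 4)%N & forall x, P x -> color x <> k.
Proof.
move=> [p [V [dimV ->]]]; apply: contrapT => all_colors.
have attained k : (k < 4)%N -> exists2 x, x - p \in V & color x = k.
  move=> k4; apply: contrapT => nx; apply: all_colors; exists k => // x xV xk.
  by apply: nx; exists x.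
have [a aV] := attained 0%N isT; have [b bV] := attained 1%N isT.
have [c cV] := attained 2%N isT; have [d dV] := attained 3%N isT.
move: (color_coord a) (color_coord b) (color_coord c) (color_coord d).
move=> + + + + d3 c2 b1 a0; rewrite d3 c2 b1 a0.
move=> [{}a0 a1 a2] [b0 {}b1 b2] [c1 {}c2] d2.
have subV x : x - p \in V -> x - a \in V.
  by move=> xV; rewrite -(subrKA p) -(opprB a) memvB.
suff: (3 <= \dim V)%N by rewrite dimV.
apply: (echelon3_dim (subV _ bV) (subV _ cV) (subV _ dV)
          (i := inord 0) (j := inord 1) (k := inord 2)).
all: rewrite !mxE ?a1 ?a2 ?b1 ?b2 ?c2 ?subr0 //.
by rewrite subr_eq0 gt_eqF // (le_lt_trans a0).
Qed.

(** One unit vector for each colour 0, 1, 2, 3: -e_0, e_0, e_1, e_2. *)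
Definition color_vector (R : realType) (n k : nat) : 'rV[R]_n.+1 :=
  (-1) ^+ (k == 0%N) *: delta_mx 0 (inord k.-1).

Lemma color_vector_unit (R : realType) (n k : nat) :
  \sum_(i < n.+1) color_vector R n k 0 i ^+ 2 == 1.
Proof.
rewrite (bigD1 (inord k.-1)) //= big1 => [|i ik].
  by rewrite !mxE !eqxx mulr1 addr0 sqrr_sign.
by rewrite !mxE (negPf ik) andbF mulr0 expr0n.
Qed.

Definition color_point (R : realType) (n k : nat) : sphere R n :=
  exist _ (color_vector R n k) (color_vector_unit R n k).

Lemma color_pointK (R : realType) (n k : nat) : (2 <= n)%N -> (k < 4)%N ->
  color (val (color_point R n k)) = k.
Proof.
move=> n2 k4.
have inordE i j : (i < 3)%N -> (j < 3)%N ->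
    (inord i == inord j :> 'I_n.+1) = (i == j).
  by move=> i3 j3; rewrite -val_eqE /= !inordK // ?(leq_trans i3) ?(leq_trans j3).
rewrite /color /= !mxE !eqxx /=.
case: k k4 => [|[|[|[|//]]]] _ /=; rewrite !inordE //=.
- by rewrite !mulr0 mulr1 eqxx /= ltr0N1.
- by rewrite !mulr0 mulr1 eqxx /= ltr01.
- by rewrite !mulr0 mulr1 eqxx /= oner_eq0.
- by rewrite mulr1 /= oner_eq0.
Qed.

Lemma circle_misses_color (R : realType) (n : nat) (C : set (sphere R n)) :
  is_circle C -> exists2 k, (k < 4)%N & forall x, C x -> color (val x) <> k.
Proof.
move=> [[P [/affine_plane_misses_color[k k4 Pk] ->]] _].
by exists k => // x /Pk.
Qed.

Theorem proposition6p2 (R : realType) (n : nat) (hn : (2 <= n)%N) :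
  exists T : sphere R 2 -> sphere R n,
    [/\ weakly_circle_preserving T,
        (range T #= `I_4)%card &
        ~ exists C : set (sphere R n), is_circle C /\ range T `<=` C].
Proof.
have q_inj : {in `I_4 &, injective (color_point R n)}.
  move=> i j; rewrite !inE /= => i4 j4 eqij.
  by rewrite -(color_pointK R hn i4) eqij color_pointK.
pose T (x : sphere R 2) := color_point R n (color (val x)).
have rangeT : range T = color_point R n @` `I_4.
  apply/seteqP; split=> [_ [x _ <-]|_ [k k4 <-]].
    by exists (color (val x)) => //=; exact: ltn_color.
  by exists (color_point R 2 k) => //; rewrite /T color_pointK.
exists T; split.
- move=> C /circle_misses_color[k k4 Ck].
  (* the three colours other than k are k+1, k+2, k+3 modulo 4 *)
  have [|C' [circC' C1 C2 C3]] := @exists_circle3 R n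
      (color_point R n (k.+1 %% 4)) (color_point R n (k.+2 %% 4))
      (color_point R n (k.+3 %% 4)) (ltnW hn).
    move=> /q_inj; rewrite !inE /= !ltn_mod => /(_ isT isT).
    by case: k k4 {Ck} => [|[|[|[|]]]].
  exists C'; split=> // _ [x /Ck xk <-]; rewrite /T.
  move: (color _) (ltn_color (val x)) xk C1 C2 C3 => c.
  by case: k k4 {Ck} => [|[|[|[|]]]] //; case: c => [|[|[|[|]]]].
- by rewrite rangeT; apply: inj_card_eq.
- move=> [C [/circle_misses_color[k k4 Ck] TC]].
  apply: (Ck (color_point R n k)); last exact: color_pointK.
  by apply: TC; rewrite rangeT; exists k.
Qed.
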